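(* Let $p\in[1,\infty]$ and $d\in\mathbb N$. For $n\in\mathbb N$ let $s_n\in\mathbb N$ and let $\mathbf w^{(n)}=(\mathbf w^{(n)}_0,\dots,\mathbf w^{(n)}_{s_n})\in\mathbb R^{s_n+1}$ be filter masks, let $m_0:=d$, $m_n:=m_{n-1}+s_n$, and let $\mathbf b_n\in\mathbb R^{m_n}$ be bias vectors. Suppose $\sum_{n=1}^\infty\|\mathbf b_n\|_p<\infty$, the infinite product $\prod_{n=1}^\infty\mathbf w^{(n)}_0$ converges to a nonzero limit (in particular all $\mathbf w^{(n)}_0\neq0$), and $$\sum_{n=1}^\infty\frac{\sum_{j=1}^{s_n}|\mathbf w^{(n)}_j|}{|\mathbf w^{(n)}_0|}<\infty.$$ Then the deep ReLU convolutional neural networks $x^{(n)}$ converge pointwise on $[0,1]^d$, i.e. for each $x\in[0,1]^d$ the sequence $\tilde x^{(n)}$ converges in $\ell^p$.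
   Context: $\sigma(t)=\max(t,0)$ applied componentwise. For $\mathbf x\in\mathbb R^m$ and $\mathbf w=(\mathbf w_0,\dots,\mathbf w_s)$, the convolution $\mathbf x*\mathbf w\in\mathbb R^{m+s}$ has entries $(\mathbf x*\mathbf w)_i=\sum_{j=\max(0,i-m)}^{\min(i-1,s)}\mathbf w_j\mathbf x_{i-j}$, $1\le i\le m+s$; equivalently $\mathbf x*\mathbf w=\mathbf W\mathbf x$ with $\mathbf W\in\mathbb R^{(m+s)\times m}$, $\mathbf W_{jk}=\mathbf w_{j-k}$ if $0\le j-k\le s$ and $0$ otherwise. The CNN is defined by $x^{(0)}:=x\in[0,1]^d$ and $x^{(n)}:=\sigma(x^{(n-1)}*\mathbf w^{(n)}+\mathbf b_n)\in\mathbb R^{m_n}$; $\tilde x^{(n)}\in\ell^p$ denotes $x^{(n)}$ extended by zeros beyond its first $m_n$ entries. *)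

(* Defs.v *)
From HB Require Import structures.
From mathcomp Require Import all_boot all_order all_algebra.
From mathcomp Require Import all_classical all_reals all_analysis.
Set Implicit Arguments. Unset Strict Implicit. Unset Printing Implicit Defensive.
Import Order.TTheory GRing.Theory Num.Theory.
Import numFieldNormedType.Exports.
Local Open Scope ring_scope.

Section CNN.
Variable R : realType.

Definition lpnorm (p : \bar R) (y : nat -> R) : \bar R :=
  match p with
  | r%:E => poweR (\sum_(0 <= k <oo) (`|y k| `^ r)%:E)%E r^-1
  | _ => ereal_sup (range (fun k => (`|y k|)%:E))
  end.

Fixpoint msize (d : nat) (s : nat -> nat) (n : nat) : nat :=
  match n with
  | 0 => d
  | n'.+1 => (msize d s n' + s n'.+1)%N
  end.

(* (x * w)_i = sum_{j = max(0, i-m)}^{min(i-1, s)} w_j x_{i-j}  (1-based x) *)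
Definition conv (m s : nat) (w : nat -> R) (x : nat -> R) (i : nat) : R :=
  \sum_((i - m)%N <= j < (minn i.-1 s).+1) w j * x (i - j)%N.

Definition relu (t : R) : R := Num.max t 0.

(* Layer n of the CNN, as a 1-based vector of length m_n, extended by zeros.
   w n j = w^(n)_j (0 <= j <= s n), b n i = (b_n)_i (1 <= i <= m_n). *)
Fixpoint cnn (d : nat) (s : nat -> nat) (w b : nat -> nat -> R) (x : nat -> R)
    (n : nat) : nat -> R :=
  match n with
  | 0 => fun i => if (1 <= i <= d)%N then x i else 0
  | n'.+1 => fun i =>
      if (1 <= i <= msize d s n'.+1)%N then
        relu (conv (msize d s n') (s n'.+1) (w n'.+1) (cnn d s w b x n') i
              + b n'.+1 i)
      else 0
  end.

Definition xtilde d s w b x n : nat -> R := fun k => cnn d s w b x n k.+1.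

Definition bvec (d : nat) (s : nat -> nat) (b : nat -> nat -> R) (n : nat) : nat -> R :=
  fun k => if (k < msize d s n)%N then b n k.+1 else 0.

End CNN.

(* Main.v *)
Require Import Defs.
From HB Require Import structures.
From mathcomp Require Import all_boot all_order all_algebra.
From mathcomp Require Import all_classical all_reals all_analysis.
From mathcomp Require Import ring lra zify.
Import Order.TTheory GRing.Theory Num.Theory.
Import numFieldNormedType.Exports.
Local Open Scope classical_set_scope.
Local Open Scope ring_scope.

(* Put P_n = w^(1)_0 ... w^(n)_0.  Once w^(n)_0 > 0, the vector w^(n)_0 x^(n-1) is
   nonnegative, hence fixed by the ReLU, so the 1-Lipschitz ReLU and Young's inequality give
     ||x^(n) - w^(n)_0 x^(n-1)|| <= (sum_(j >= 1) |w^(n)_j|) ||x^(n-1)|| + ||b_n||.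
   After division by P_n, which stays away from 0, the rescaled layers z_n = x^(n) / P_n satisfy
   ||z_n - z_(n-1)|| <= e_n ||z_(n-1)|| + beta_n with e and beta summable.  By Gronwall they are
   bounded, hence Cauchy in l^p with a limit y, and x^(n) = P_n z_n tends to (lim P_n) y. *)

(** * Norm estimates in l^p for 1 <= p <= infinity *)

Section LpNorm.
Context {R : realType}.
Implicit Types (p : \bar R) (f g : nat -> R) (C c : R).

(** Monotonicity of the powers [r] and [r^-1] on [0, +oo] trades the root and the infinite series
    for finite real sums, on which several estimates below are carried out. *)
Lemma lpnorm_finP (r C : R) f : 1 <= r -> 0 <= C ->
  ((lpnorm r%:E f <= C%:E)%E <->
   forall n, \sum_(0 <= k < n) `|f k| `^ r <= C `^ r).
Proof.
move=> r1 C0; have r0 : 0 < r by exact: lt_le_trans r1.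
have term0 k : (0 <= (`|f k| `^ r)%:E)%E by rewrite lee_fin powR_ge0.
set S := (\sum_(0 <= k <oo) (`|f k| `^ r)%:E)%E.
have S0 : (0 <= S)%E by apply: nneseries_ge0.
have -> : lpnorm r%:E f = (S `^ r^-1)%E by [].
have inI (x : \bar R) : (0 <= x)%E -> x \in `[0%E, +oo%E].
  by move=> x0; rewrite in_itv; apply/andP; split=> //; exact: leey.
have -> : (S `^ r^-1 <= C%:E)%E <-> (S <= (C `^ r)%:E)%E.
  split=> h.
  - have := gt0_ler_poweR (ltW r0) (inI _ (poweR_ge0 _ _)) (inI C%:E C0) h.
    by rewrite -poweRrM mulVf ?gt_eqF// poweRe1// poweR_EFin.
  - have ri0 : 0 <= r^-1 by rewrite invr_ge0 ltW.
    have := gt0_ler_poweR ri0 (inI _ S0) (inI _ (poweR_ge0 C%:E r)) h.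
    by rewrite -poweRrM mulfV ?gt_eqF// poweRe1.
split=> h.
- move=> n; rewrite -lee_fin -sumEFin; apply: le_trans h.
  by apply: nneseries_lim_ge => k _ _.
- apply: lime_le; first by apply: is_cvg_nneseries => k _ _.
  by apply: nearW => n; rewrite sumEFin lee_fin.
Qed.

Lemma lpnorm_pinftyP C f :
  (lpnorm +oo%E f <= C%:E)%E <-> forall k, `|f k| <= C.
Proof.
split=> [h k|h].
- rewrite -lee_fin; apply: le_trans h.
  by apply: ereal_sup_ubound; exists k.
- by apply: ge_ereal_sup => _ [k _ <-]; rewrite lee_fin.
Qed.

Lemma lpnorm_ge0 p f : (0 <= lpnorm p f)%E.
Proof.
have sup0 : (0 <= ereal_sup (range (fun k => `|f k|%:E)))%E.
  apply: le_trans (ereal_sup_ubound _); last by exists 0%N.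
  by rewrite lee_fin.
by case: p => [r||] //=; rewrite poweR_ge0.
Qed.

Lemma lpnorm_fin_num p f : (lpnorm p f < +oo)%E -> lpnorm p f \is a fin_num.
Proof. by move=> h; rewrite ge0_fin_numE ?lpnorm_ge0. Qed.

Lemma le_lpnorm p f g : (1 <= p)%E -> (forall k, `|f k| <= `|g k|) ->
  (lpnorm p f <= lpnorm p g)%E.
Proof.
move=> p1 fg.
have [goo|] := ltP (lpnorm p g) +oo%E; last by rewrite leye_eq => /eqP->; rewrite leey.
have gf := lpnorm_fin_num _ _ goo.
rewrite -(fineK gf); have C0 := fine_ge0 (lpnorm_ge0 p g).
have : (lpnorm p g <= (fine (lpnorm p g))%:E)%E by rewrite fineK.
move: (fine _) C0 => C C0 {goo gf}.
case: p p1 => [r||//] p1.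
- move=> /(lpnorm_finP _ _ _ p1 C0) h; apply/(lpnorm_finP _ _ _ p1 C0) => n.
  apply: le_trans (h n); apply: ler_sum => k _.
  by apply: ge0_ler_powR; rewrite ?nnegrE// (le_trans ler01).
- move=> /lpnorm_pinftyP h; apply/lpnorm_pinftyP => k.
  exact: le_trans (fg k) (h k).
Qed.

Lemma normr_le_lpnorm p C f k : (1 <= p)%E -> 0 <= C ->
  (lpnorm p f <= C%:E)%E -> `|f k| <= C.
Proof.
move=> p1 C0; case: p p1 => [r||//] p1; last by move=> /lpnorm_pinftyP.
have r0 : 0 < r := lt_le_trans ltr01 p1.
move=> /(lpnorm_finP _ _ _ p1 C0) /(_ k.+1); rewrite big_nat_recr//= => h.
have {}h : `|f k| `^ r <= C `^ r.
  apply: le_trans h; rewrite lerDr sumr_ge0// => i _; exact: powR_ge0.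
rewrite leNgt; apply/negP => Cf; move: h; apply/negP; rewrite -ltNge.
by apply: gt0_ltr_powR; rewrite ?nnegrE.
Qed.

Lemma lpnormD p f g : (1 <= p)%E ->
  (lpnorm p (fun k => f k + g k)%R <= lpnorm p f + lpnorm p g)%E.
Proof.
case: p => [r||//] p1.
- have r0 : 0 < r := lt_le_trans ltr01 p1.
  (* For finite [p] the norm is the L^r norm of the counting measure, so Minkowski's inequality
     applies. *)
  have NE h : lpnorm r%:E h = 'N[counting]_r%:E[EFin \o h]%E.
    by rewrite Lnorm_counting//=; congr (poweR _ _).
  by rewrite !NE; apply: eminkowski.
- apply: ge_ereal_sup => _ [k _ <-].
  apply: (@le_trans _ _ (`|f k|%:E + `|g k|%:E)%E); first by rewrite -EFinD lee_fin ler_normD.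
  by apply: leeD; apply: ereal_sup_ubound; exists k.
Qed.

Lemma lpnormD_le p C c f g : (1 <= p)%E ->
  (lpnorm p f <= C%:E)%E -> (lpnorm p g <= c%:E)%E ->
  (lpnorm p (fun k => f k + g k)%R <= (C + c)%:E)%E.
Proof.
by move=> p1 hf hg; rewrite EFinD (le_trans (lpnormD _ _ _ p1))// leeD.
Qed.

Lemma lpnormZ_le p C c f : (1 <= p)%E -> 0 <= C ->
  (lpnorm p f <= C%:E)%E -> (lpnorm p (fun k => c * f k)%R <= (`|c| * C)%:E)%E.
Proof.
move=> p1 C0; have cC0 : 0 <= `|c| * C by rewrite mulr_ge0.
case: p p1 => [r||//] p1.
- move=> /(lpnorm_finP _ _ _ p1 C0) h; apply/(lpnorm_finP _ _ _ p1 cC0) => n.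
  rewrite powRM// (le_trans _ (ler_wpM2l (powR_ge0 _ _) (h n)))// mulr_sumr.
  by apply: ler_sum => k _; rewrite normrM powRM.
- move=> /lpnorm_pinftyP h; apply/lpnorm_pinftyP => k.
  by rewrite normrM ler_wpM2l.
Qed.

(** Convolution with a mask is the combination of these zero-padded shifts with the mask entries as
    coefficients; no shift increases an l^p norm. *)
Definition shift (j : nat) f (k : nat) : R := if (j <= k)%N then f (k - j)%N else 0.

Lemma lpnorm_shift p j C f : (1 <= p)%E -> 0 <= C ->
  (lpnorm p f <= C%:E)%E -> (lpnorm p (shift j f) <= C%:E)%E.
Proof.
move=> p1 C0; case: p p1 => [r||//] p1.
- have r0 : r != 0 by rewrite gt_eqF// (lt_le_trans ltr01 p1).
  move=> /(lpnorm_finP _ _ _ p1 C0) h; apply/(lpnorm_finP _ _ _ p1 C0) => n.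
  have [nj|jn] := leqP n j.
    rewrite big_nat big1 ?powR_ge0// => k /andP[_ kn].
    by rewrite /shift leqNgt (leq_trans kn nj)/= normr0 powR0.
  rewrite (@big_cat_nat _ _ _ j)//= 1?ltnW// big_nat big1 ?add0r; last first.
    by move=> k /andP[_ kj]; rewrite /shift leqNgt kj/= normr0 powR0.
  rewrite -{1}[j]add0n big_addn (le_trans _ (h (n - j)%N))//.
  by apply: ler_sum => k _; rewrite /shift leq_addl addnK.
- move=> /lpnorm_pinftyP h; apply/lpnorm_pinftyP => k.
  by rewrite /shift; case: ifP => // _; rewrite normr0.
Qed.

(** At [l > 0] differentiability of the power suffices; at [l = 0] the powers are squeezed between 0
    and [u n] itself, once [u n <= 1]. *)
Lemma cvg_powR (r : R) (u : nat -> R) (l : R) : 1 <= r -> (forall n, 0 <= u n) ->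
  u @ \oo --> l -> (fun n => u n `^ r) @ \oo --> l `^ r.
Proof.
move=> r1 u0 ul; have r0 : 0 < r := lt_le_trans ltr01 r1.
have : 0 <= l by apply: (cvgr_to_ge ul); exact: nearW.
rewrite le_eqVlt => /predU1P[l0|l0].
- rewrite -l0 powR0 ?gt_eqF//; rewrite -l0 in ul.
  apply: (squeeze_cvgr _ (cvg_cst 0) ul).
  have : \forall n \near \oo, u n <= 1 by apply: cvgr_le ul _ ltr01.
  apply: filterS => n un1.
  rewrite powR_ge0/=; move: (u0 n); rewrite le_eqVlt => /predU1P[<-|un0].
    by rewrite powR0 ?gt_eqF.
  by apply: ge1r_powR => //; rewrite un0.
- apply: (@continuous_cvg _ _ _ _ _ u (fun t : R => t `^ r)) => //.
  apply: differentiable_continuous; apply/derivable1_diffP.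
  by apply: derivable_powR; rewrite in_itv/= l0.
Qed.

(** A Fatou-type property: a partial sum involves finitely many coordinates, so its bound passes to
    the limit. Coordinatewise convergence is all that is known when completeness is proved. *)
Lemma lpnorm_cvg_le p C (u : nat -> nat -> R) f : (1 <= p)%E -> 0 <= C ->
  (forall k, u ^~ k @ \oo --> f k) ->
  (\forall n \near \oo, (lpnorm p (u n) <= C%:E)%E) -> (lpnorm p f <= C%:E)%E.
Proof.
move=> p1 C0 uf; case: p p1 => [r||//] p1 hu.
- have r0 : 0 < r := lt_le_trans ltr01 p1.
  apply/(lpnorm_finP _ _ _ p1 C0) => K.
  have cv : (fun n => \sum_(0 <= k < K) `|u n k| `^ r) @ \oo -->
            \sum_(0 <= k < K) `|f k| `^ r.
    elim: K => [|K IH].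
      by under eq_fun do rewrite big_nil; rewrite big_nil; exact: cvg_cst.
    under eq_fun do rewrite big_nat_recr//=; rewrite big_nat_recr//=.
    by apply: cvgD => //; apply: cvg_powR => //; exact: cvg_norm.
  apply: (cvgr_to_le cv); apply: filterS hu => n.
  by move=> /(lpnorm_finP _ _ _ p1 C0); apply.
- apply/lpnorm_pinftyP => k.
  apply: (cvgr_to_le (cvg_norm (uf k))); apply: filterS hu => n.
  by move=> /lpnorm_pinftyP; apply.
Qed.

Lemma lpnorm_finsupp p m f : (1 <= p)%E ->
  (forall k, (m <= k)%N -> f k = 0) -> (lpnorm p f < +oo)%E.
Proof.
move=> p1 f0; case: p p1 => [r||//] p1.
- have r0 : 0 < r := lt_le_trans ltr01 p1.
  rewrite /= poweR_lty// (nneseries_split _ m)/=; last first.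
    by move=> k _; rewrite lee_fin powR_ge0.
  rewrite add0n eseries0 ?adde0 ?sumEFin ?ltry// => k mk _.
  by rewrite f0// normr0 powR0// gt_eqF.
(* The sum of the first [m] absolute values is a crude bound for the supremum. *)
- apply: (@le_lt_trans _ _ (\sum_(0 <= k < m) `|f k|)%:E); last by rewrite ltry.
  apply/lpnorm_pinftyP => k; have [mk|km] := leqP m k.
    by rewrite f0// normr0 sumr_ge0.
  rewrite (big_cat_nat (n := k.+1))//= big_nat_recr//= -addrA addrCA lerDl.
  by rewrite addr_ge0 ?sumr_ge0.
Qed.

Lemma lpnorm0 p : (1 <= p)%E -> (lpnorm p (fun=> 0%R : R) <= 0%:E)%E.
Proof.
case: p => [r||//] p1.
- have r0 : r != 0 by rewrite gt_eqF// (lt_le_trans ltr01 p1).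
  apply/(lpnorm_finP _ _ _ p1 (lexx 0)) => n.
  by rewrite big1 ?powR_ge0// => k _; rewrite normr0 powR0.
- by apply/lpnorm_pinftyP => k; rewrite normr0.
Qed.

End LpNorm.

(** * Completeness of l^p and summable perturbations *)

Section Completeness.
Context {R : realType}.
Implicit Types (p : \bar R) (eta e beta : nat -> R).

Lemma cvg_bounded_series eta (B : R) : (forall n, 0 <= eta n) ->
  (forall n, \sum_(0 <= i < n) eta i <= B) -> cvgn (series eta).
Proof.
move=> eta0 etaB; apply: nondecreasing_is_cvgn.
  by apply/nondecreasing_seqP => n; rewrite seriesSr lerDl.
by exists B => _ [n _ <-]; exact: etaB.
Qed.

(* Adding the partial sums of eta makes each coordinate sequence monotone and bounded. *)
Lemma lpnorm_complete p (z : nat -> nat -> R) eta (B : R) : (1 <= p)%E ->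
  (forall n, 0 <= eta n) -> (forall n, \sum_(0 <= i < n) eta i <= B) ->
  (forall n, (lpnorm p (fun k => z n.+1 k - z n k)%R <= (eta n)%:E)%E) ->
  exists2 y : nat -> R,
    (forall n, (lpnorm p (fun k => y k - z n k)%R
                <= (limn (series eta) - series eta n)%:E)%E) &
    cvgn (series eta).
Proof.
move=> p1 eta0 etaB dz.
have cu := cvg_bounded_series _ _ eta0 etaB.
set u := series eta in cu *.
have u_nd : nondecreasing_seq u by apply/nondecreasing_seqP => n; rewrite /u seriesSr lerDl.
have u_le n : u n <= limn u by apply: nondecreasing_cvgn_le.
have dzk n k : `|z n.+1 k - z n k| <= eta n by exact: normr_le_lpnorm (dz n).
have cz k : cvgn (z ^~ k).
  have cv : cvgn (fun n => z n k + u n).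
    apply: nondecreasing_is_cvgn.
      apply/nondecreasing_seqP => n; rewrite /u seriesSr.
      by have := dzk n k; rewrite ler_norml => /andP[h _]; lra.
    exists (z 0%N k + B + B) => _ [n _ <-].
    have zu : z n k <= z 0%N k + u n.
      elim: n => [|n IH]; first by rewrite /u seriesEnat/= big_nil addr0.
      rewrite /u seriesSr.
      by have := dzk n k; rewrite ler_norml => /andP[_ h]; move: IH; rewrite /u; lra.
    have uB : u n <= B by exact: etaB.
    lra.
  have -> : z ^~ k = (fun n => z n k + u n - u n) by apply/funext => n; lra.
  exact: is_cvgB.
exists (fun k => limn (z ^~ k)) => // n.
have dzm m : (lpnorm p (fun k => z (n + m)%N k - z n k)%R <= (u (n + m)%N - u n)%:E)%E.
  elim: m => [|m IH].
    by rewrite addn0 subrr; under eq_fun do rewrite subrr; exact: lpnorm0.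
  have -> : (fun k => z (n + m.+1)%N k - z n k) =
      (fun k => (z (n + m).+1%N k - z (n + m)%N k) + (z (n + m)%N k - z n k)).
    by apply/funext => k; rewrite addnS; lra.
  have -> : u (n + m.+1)%N - u n = eta (n + m)%N + (u (n + m)%N - u n).
    by rewrite addnS /u seriesSr; lra.
  exact: lpnormD_le.
(* With [n] fixed and [i] tending to infinity, the telescoped bound, at most [limn u - u n], passes
   to the coordinatewise limit. *)
apply: (@lpnorm_cvg_le _ _ _ (fun i k => z i k - z n k)) => //.
- by rewrite subr_ge0.
- by move=> k; apply: cvgB; [exact: cz|exact: cvg_cst].
- exists n => //= i ni; rewrite -(subnKC ni) (le_trans (dzm _))// lee_fin.
  by rewrite lerD2r.
Qed.

Lemma discrete_gronwall e beta (nu : nat -> R) (E B : R) :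
  (forall n, 0 <= e n) -> (forall n, 0 <= beta n) -> (forall n, 0 <= nu n) ->
  (forall n, \sum_(0 <= i < n) e i <= E) ->
  (forall n, \sum_(0 <= i < n) beta i <= B) ->
  (forall n, nu n.+1 <= nu n + (e n * nu n + beta n)) ->
  forall n, nu n <= (1 + nu 0%N) * expR (E + B).
Proof.
move=> e0 b0 nu0 eE bB nuS n.
(* Passing to 1 + nu turns the additive error beta into a multiplicative one. *)
have : 1 + nu n <= (1 + nu 0%N) * expR (\sum_(0 <= i < n) (e i + beta i)).
  elim: n => [|n IH]; first by rewrite big_nil expR0 mulr1.
  rewrite big_nat_recr//= expRD mulrA.
  (* The surplus on the right is [e n + beta n * nu n], which is nonnegative; then 1 + t <= exp
     t. *)
  apply: (@le_trans _ _ ((1 + nu n) * (1 + (e n + beta n)))).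
    have := nuS n; have := mulr_ge0 (b0 n) (nu0 n); have := e0 n.
    nra.
  have := expR_ge1Dx (e n + beta n).
  by apply: ler_pM; rewrite ?addr_ge0.
have : expR (\sum_(0 <= i < n) (e i + beta i)) <= expR (E + B).
  by rewrite ler_expR big_split/= lerD.
move=> /(ler_wpM2l (_ : 0 <= 1 + nu 0%N)) h1 h2.
have := h1 (addr_ge0 ler01 (nu0 _)); lra.
Qed.

(** The growth condition is tested against every real bound [C], so that the iteration runs on real
    numbers although norms are extended reals. *)
Lemma lpnorm_cvg_perturbation p (z : nat -> nat -> R) e beta (E B : R) : (1 <= p)%E ->
  (forall n, 0 <= e n) -> (forall n, 0 <= beta n) ->
  (forall n, \sum_(0 <= i < n) e i <= E) ->
  (forall n, \sum_(0 <= i < n) beta i <= B) ->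
  (lpnorm p (z 0%N) < +oo)%E ->
  (forall n C, 0 <= C -> (lpnorm p (z n) <= C%:E)%E ->
     (lpnorm p (fun k => z n.+1 k - z n k)%R <= (e n * C + beta n)%:E)%E) ->
  exists2 y : nat -> R, (lpnorm p y < +oo)%E &
    exists2 t : nat -> R, t @ \oo --> 0 &
    forall n, 0 <= t n /\ (lpnorm p (fun k => y k - z n k)%R <= (t n)%:E)%E.
Proof.
move=> p1 e0 b0 eE bB z0 dz.
(* [nu] solves the recursion with equality and so majorizes the norms of [z n] by real numbers. *)
pose nu := fix nu n := if n is m.+1 then nu m + (e m * nu m + beta m)
                       else fine (lpnorm p (z 0%N)).
have nu0 n : 0 <= nu n.
  by elim: n => [|n IH] /=; rewrite ?fine_ge0 ?lpnorm_ge0// !addr_ge0// mulr_ge0.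
have znu n : (lpnorm p (z n) <= (nu n)%:E)%E.
  elim: n => [|n IH]; first by rewrite /= fineK ?lpnorm_fin_num.
  have -> : z n.+1 = (fun k => z n k + (z n.+1 k - z n k)).
    by apply/funext => k; lra.
  by apply: lpnormD_le => //; exact: dz.
have nuM := discrete_gronwall _ _ _ _ _ e0 b0 nu0 eE bB (fun n => lexx _).
set M := (1 + nu 0%N) * expR (E + B) in nuM.
have M0 : 0 <= M by rewrite mulr_ge0 ?expR_ge0// addr_ge0.
(* With the Gronwall bound [M], the increments are bounded by a sequence whose partial sums stay
   below [E * M + B]. *)
pose eta n := e n * M + beta n.
have eta0 n : 0 <= eta n by rewrite addr_ge0// mulr_ge0.
have etaB n : \sum_(0 <= i < n) eta i <= E * M + B.
  by rewrite big_split/= -mulr_suml lerD// ler_wpM2r.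
have dzeta n : (lpnorm p (fun k => z n.+1 k - z n k)%R <= (eta n)%:E)%E.
  by apply: dz => //; rewrite (le_trans (znu n))// lee_fin.
have [y yz ceta] := lpnorm_complete _ _ _ _ p1 eta0 etaB dzeta.
exists y.
  have -> : y = (fun k => z 0%N k + (y k - z 0%N k)) by apply/funext => k; lra.
  by rewrite (le_lt_trans (lpnormD_le _ _ _ _ _ p1 (znu 0%N) (yz 0%N)))// ltry.
(* The errors are the tails of the series of [eta]. *)
exists (fun n => limn (series eta) - series eta n).
  by rewrite -[X in _ --> X](subrr (limn (series eta))); apply: cvgB => //; exact: cvg_cst.
move=> n; split=> //; rewrite subr_ge0; apply: nondecreasing_cvgn_le => //.
by apply/nondecreasing_seqP => m; rewrite seriesSr lerDl.
Qed.

End Completeness.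

(** * A single convolutional layer *)

Section Layers.
Context {R : realType} (d : nat) (s : nat -> nat) (w b : nat -> nat -> R) (x : nat -> R).
Local Notation X := (xtilde d s w b x).

Lemma xtilde_out n k : (msize d s n <= k)%N -> X n k = 0.
Proof. by move=> mk; case: n mk => [|n] /= mk; rewrite /xtilde/= ltnNge mk. Qed.

Lemma xtilde_ge0 n k : 0 <= X n.+1 k.
Proof. by rewrite /xtilde/=; case: ifP => // _; rewrite /relu le_max lexx orbT. Qed.

(** Zero padding absorbs the truncated index range of [conv]: terms with [j] below it vanish since
    [X n] is zero from [msize d s n] on, terms above it since [shift j] is zero at [k < j]. *)
Lemma xtildeS n k : X n.+1 k =
  relu (\sum_(0 <= j < (s n.+1).+1) w n.+1 j * shift j (X n) k + bvec d s b n.+1 k).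
Proof.
rewrite {1}/xtilde /bvec [LHS]/=; case: ltnP => [km|mk]; last first.
  (* Past the end of layer [n.+1], [j <= s n.+1] forces [k - j >= msize d s n], so all terms are
     zero, and the ReLU fixes 0. *)
  rewrite addr0 big_nat big1 ?/relu ?maxxx// => j /andP[_ js].
  rewrite /shift; case: ifP => jk; rewrite ?mulr0// xtilde_out ?mulr0//.
  lia.
congr (relu (_ + _)); rewrite /conv/=.
rewrite [RHS](@big_cat_nat _ _ _ (k.+1 - msize d s n))//=; last lia.
rewrite [X in X + _]big_nat [X in X + _]big1 ?add0r => [|j /andP[_ jk]]; last first.
  by rewrite /shift; case: ifP; rewrite ?mulr0// xtilde_out ?mulr0//; lia.
rewrite [RHS](@big_cat_nat _ _ _ (minn k (s n.+1)).+1)//=; [|lia|lia].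
rewrite [X in _ + X]big_nat [X in _ + X]big1 ?addr0 => [|j /andP[kj jn]]; last first.
  by rewrite /shift; case: ifP; rewrite ?mulr0//; lia.
apply: eq_big_nat => j /andP[_ jk]; have {}jk : (j <= k)%N by lia.
by rewrite /shift jk /xtilde subSn.
Qed.

(** Since [u = relu u], this is the 1-Lipschitz bound for the ReLU. *)
Lemma relu_perturb (u t : R) : 0 <= u -> `|relu (u + t) - u| <= `|t|.
Proof.
move=> u0; rewrite /relu ler_norml.
have := ler_norm t; have := ler_norm (- t); rewrite normrN.
by case: (leP (u + t) 0) => ? ? ?; lra.
Qed.

(** Young's inequality between l^1 and l^p, from the triangle inequality and the norm bound for
    shifts. An arbitrary list [r] permits induction and, below, the sum without its term [j = 0]. *)
Lemma lpnorm_conv_le (p : \bar R) (r : seq nat) (v : nat -> R) C f :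
  (1 <= p)%E -> 0 <= C -> (lpnorm p f <= C%:E)%E ->
  (lpnorm p (fun k => \sum_(j <- r) v j * shift j f k)%R
   <= ((\sum_(j <- r) `|v j|) * C)%:E)%E.
Proof.
move=> p1 C0 fC; elim: r => [|j r IH].
  by rewrite big_nil mul0r; under eq_fun do rewrite big_nil; exact: lpnorm0.
rewrite big_cons mulrDl; under eq_fun do rewrite big_cons.
by apply: lpnormD_le => //; apply: lpnormZ_le => //; exact: lpnorm_shift.
Qed.

Lemma lpnorm_layer (p : \bar R) n C B : (1 <= p)%E -> 0 <= C -> 0 <= w n.+2 0%N ->
  (lpnorm p (X n.+1) <= C%:E)%E -> (lpnorm p (bvec d s b n.+2) <= B%:E)%E ->
  (lpnorm p (fun k => X n.+2 k - w n.+2 0%N * X n.+1 k)%R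
   <= ((\sum_(1 <= j < (s n.+2).+1) `|w n.+2 j|) * C + B)%:E)%E.
Proof.
move=> p1 C0 w0 XC bB.
apply: le_trans (lpnormD_le _ _ _ _ _ p1 (lpnorm_conv_le _ _ _ _ _ p1 C0 XC) bB).
(* [shift 0] is the identity, so the term [j = 0] is the nonnegative vector fixed by the ReLU; the
   other terms and the bias form its perturbation. *)
apply: le_lpnorm => // k; rewrite xtildeS big_ltn// {1}/shift leq0n subn0 -addrA.
by apply: relu_perturb; rewrite mulr_ge0 ?xtilde_ge0.
Qed.

End Layers.

(** * Convergence of the rescaled layers and of the network *)

Lemma nneseries_tail_bounded {R : realType} (f : nat -> \bar R) (m N : nat) :
  (forall n, (0 <= f n)%E) -> (\sum_(m <= n <oo) f n < +oo)%E -> (m <= N)%N ->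
  (forall i, f (i + N)%N \is a fin_num) /\
  exists B, forall n, \sum_(0 <= i < n) fine (f (i + N)%N) <= B.
Proof.
move=> f0 fS mN.
have S0 : (0 <= \sum_(m <= n <oo) f n)%E by exact: nneseries_ge0.
(* As the terms are nonnegative, a partial sum starting at [N] is dominated by one starting at
   [m <= N]. Applied to its last term, this also gives finiteness. *)
have part n : (\sum_(0 <= i < n) f (i + N)%N <= \sum_(m <= n <oo) f n)%E.
  apply: (@le_trans _ _ (\sum_(m <= i < n + N) f i)%E); last first.
    by apply: nneseries_lim_ge.
  rewrite [leRHS](@big_cat_nat _ _ _ N)//= ?leq_addl//.
  rewrite -{3}[N]add0n big_addn addnK leeDr//.
  by apply: sume_ge0.
have ffin i : f (i + N)%N \is a fin_num.
  rewrite ge0_fin_numE// (le_lt_trans _ fS)// (le_trans _ (part i.+1))//.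
  by rewrite big_nat_recr//= leeDr// sume_ge0.
split=> //; exists (fine (\sum_(m <= n <oo) f n)%E) => n.
rewrite -lee_fin fineK ?ge0_fin_numE// -sumEFin.
by under eq_bigr do rewrite fineK//.
Qed.

Theorem theorem6p2 (R : realType) (p : \bar R) (d : nat) (s : nat -> nat)
    (w b : nat -> nat -> R) :
  (1 <= p)%E ->
  (\sum_(1 <= n <oo) lpnorm p (bvec d s b n) < +oo)%E ->
  (forall n, (1 <= n)%N -> w n 0%N != 0) ->
  (exists2 L : R, L != 0 &
     ((fun n => \prod_(1 <= k < n.+1) w k 0%N) @ \oo --> L)) ->
  (\sum_(1 <= n <oo) ((\sum_(1 <= j < (s n).+1) `|w n j|) / `|w n 0%N|)%:E
     < +oo)%E ->
  forall x : nat -> R, (forall i, (1 <= i <= d)%N -> 0 <= x i <= 1) ->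
  exists2 y : nat -> R, (lpnorm p y < +oo)%E &
    ((fun n => lpnorm p (fun k => xtilde d s w b x n k - y k)) @ \oo --> 0%E).
Proof.
move=> p1 bS w0 [L L0 PL] wS x _.
set P := fun n => \prod_(1 <= k < n.+1) w k 0%N in PL.
have PS n : P n.+1 = P n * w n.+1 0%N by rewrite /P big_nat_recr.
(* Multiplying by [L] treats both signs at once: P_n L tends to L^2 > 0, so from [N] on P_n has the
   sign of [L] and |P_n| > |L| / 2. *)
have [N _ hN] : \forall n \near \oo, L ^+ 2 / 2 < P n * L.
  have cv : (fun n => P n * L) @ \oo --> L * L by apply: cvgM => //; exact: cvg_cst.
  by apply: (cvgr_gt _ cv); have : 0 < L ^+ 2 by [rewrite exprn_even_gt0]; nra.
have LL : 0 < L ^+ 2 by rewrite exprn_even_gt0.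
have PL0 n : (N <= n)%N -> 0 < P n * L by move=> /hN; apply: lt_trans; lra.
have P0 n : (N <= n)%N -> P n != 0.
  by move=> /PL0; apply: contraTneq => ->; rewrite mul0r ltxx.
(* The product P_(n+1) L is P_n L times the new leading coefficient, and both products are
   positive. *)
have wpos n : (N <= n)%N -> 0 < w n.+1 0%N.
  move=> Nn; have := PL0 _ (leqW Nn); rewrite PS mulrAC.
  by rewrite pmulr_rgt0// PL0.
have Pinv n : (N <= n)%N -> `|P n|^-1 <= 2 / `|L|.
  move=> Nn; have Pn : 0 < `|P n| by rewrite normr_gt0 P0.
  have Ln : 0 < `|L| by rewrite normr_gt0.
  rewrite -[leLHS]mul1r ler_pdivrMr// mulrAC ler_pdivlMr// mul1r.
  have := hN _ Nn; have := ler_norm (P n * L); rewrite normrM.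
  have : L ^+ 2 = `|L| ^+ 2 by rewrite -normrX ger0_norm// ltW.
  nra.
pose X := xtilde d s w b x.
have e_ge0 n : (0 <= ((\sum_(1 <= j < (s n).+1) `|w n j|) / `|w n 0%N|)%:E)%E.
  by rewrite lee_fin divr_ge0// sumr_ge0.
(* The rescaled sequence starts at layer N + 1, a ReLU output, so its first increment involves the
   mask and bias of index N + 2. *)
have [_ [E eE]] := nneseries_tail_bounded _ 1 N.+2 e_ge0 wS isT.
have [bfin [B bB]] := nneseries_tail_bounded _ 1 N.+2 (fun n => lpnorm_ge0 _ _) bS isT.
rewrite /= in eE.
have [||||||y yfin [t t0 ty]] := @lpnorm_cvg_perturbation _ p
  (fun i k => (P (i + N.+1)%N)^-1 * X (i + N.+1)%N k)
  (fun i => (\sum_(1 <= j < (s (i + N.+2)%N).+1) `|w (i + N.+2)%N j|)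
            / `|w (i + N.+2)%N 0%N|)
  (fun i => 2 / `|L| * fine (lpnorm p (bvec d s b (i + N.+2)%N)))
  E (2 / `|L| * B) p1.
- by move=> n; rewrite divr_ge0// sumr_ge0.
- by move=> n; rewrite mulr_ge0// ?divr_ge0// fine_ge0// lpnorm_ge0.
- exact: eE.
- by move=> n; rewrite -mulr_sumr ler_wpM2l// divr_ge0.
- apply: (lpnorm_finsupp _ (msize d s N.+1)) => // k mk.
  by rewrite /X xtilde_out ?mulr0.
- move=> n C C0 zC; rewrite !addSn !addnS.
  set q := (n + N)%N; have Nq : (N <= q)%N by exact: leq_addl.
  (* Undoing the rescaling turns the bound [C] into a bound for the layer itself, as the one-layer
     estimate requires. *)
  have XC : (lpnorm p (X q.+1) <= (`|P q.+1| * C)%:E)%E.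
    have -> : X q.+1 = (fun k => P q.+1 * ((P q.+1)^-1 * X q.+1 k)).
      by apply/funext => k; rewrite mulVKf// P0// leqW.
    by apply: lpnormZ_le => //; rewrite addnS in zC.
  have bq : (lpnorm p (bvec d s b q.+2) <=
             (fine (lpnorm p (bvec d s b q.+2)))%:E)%E.
    by rewrite fineK//; have := bfin n; rewrite !addnS.
  have PC0 : 0 <= `|P q.+1| * C by rewrite mulr_ge0.
  have wq : 0 < w q.+2 0%N by apply: wpos; rewrite leqW.
  have := lpnorm_layer _ _ _ _ _ _ _ _ _ p1 PC0 (ltW wq) XC bq.
  set tau := \sum_(1 <= j < _) _; set beta := fine _ => hX.
  have tau0 : 0 <= tau by rewrite sumr_ge0.
  have beta0 : 0 <= beta by rewrite fine_ge0// lpnorm_ge0.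
  have -> : (fun k => (P q.+2)^-1 * X q.+2 k - (P q.+1)^-1 * X q.+1 k) =
            (fun k => (P q.+2)^-1 * (X q.+2 k - w q.+2 0%N * X q.+1 k)).
    apply/funext => k; rewrite (PS q.+1); field.
    by rewrite P0 ?leqW// gt_eqF.
  apply: le_trans (lpnormZ_le _ _ _ _ p1 _ hX) _.
    by rewrite addr_ge0// mulr_ge0.
  (* Since |P_(q+2)| is |P_(q+1)| times the modulus of the leading coefficient, the mask term
     matches exactly; only the bias term needs the bound 2 / |L| on the inverse product. *)
  rewrite lee_fin mulrDr lerD//; last first.
    by rewrite ler_wpM2r// normfV Pinv// !leqW.
  rewrite PS normfV normrM le_eqVlt; apply/orP; left; apply/eqP; field.
  by rewrite !normr_eq0 P0 ?leqW// gt_eqF.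
have yf := lpnorm_fin_num _ _ yfin.
have yle : (lpnorm p y <= (fine (lpnorm p y))%:E)%E by rewrite fineK.
have y0 := fine_ge0 (lpnorm_ge0 p y).
exists (fun k => L * y k).
  by rewrite (le_lt_trans (lpnormZ_le _ _ _ _ p1 y0 yle))// ltry.
rewrite -(cvg_shiftn N.+1).
(* [r] bounds the norm of x - L y = -P (y - x / P) + (P - L) y; the first summand vanishes in the
   limit because [t] does and P stays bounded, the second because P tends to [L]. *)
pose r n := `|- P (n + N.+1)%N| * t n + `|P (n + N.+1)%N - L| * fine (lpnorm p y).
have r0 : r @ \oo --> 0.
  have PN : (fun n => P (n + N.+1)%N) @ \oo --> L by rewrite (cvg_shiftn N.+1 P).
  have -> : 0 = `|- L| * 0 + `|L - L| * fine (lpnorm p y).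
    by rewrite subrr normr0 mulr0 mul0r addr0.
  apply: cvgD; apply: cvgM => //; last exact: cvg_cst.
    by apply: cvg_norm; apply: cvgN.
  by apply: cvg_norm; apply: cvgB => //; exact: cvg_cst.
have r0E : EFin \o r @ \oo --> 0%E by apply: cvg_EFin => //; exact: nearW.
apply: (squeeze_cvge _ (cvg_cst 0%E) r0E).
apply: nearW => n; rewrite lpnorm_ge0/=.
have [tn0 tyn] := ty n.
have -> : (fun k => xtilde d s w b x (n + N.+1)%N k - L * y k) =
  (fun k => - P (n + N.+1)%N * (y k - (P (n + N.+1)%N)^-1 * X (n + N.+1)%N k)
            + (P (n + N.+1)%N - L) * y k).
  apply/funext => k; rewrite /X; field.
  by rewrite P0// addnS leqW// leq_addl.
by apply: lpnormD_le => //; apply: lpnormZ_le.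
Qed.
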